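(* Let $n\ge 1$ and $q$ be integers with $q \ge \sqrt{2n}$, and let $\mathcal{H}$ be a $q$-uniform linear hypergraph on vertex set $[n]$. Then $e(\mathcal{H}) < q$. Further, if $q\le n$ and $\mathcal{H}$ is maximal, then $e(\mathcal{H}) = \Theta\left(\frac{n}{q}\right)$; that is, there are absolute constants $c,C>0$ (independent of $n$, $q$ and $\mathcal{H}$) such that $c\,\frac{n}{q}\le e(\mathcal{H})\le C\,\frac{n}{q}$.
   Context: $[n]=\{1,\dots,n\}$. A $q$-uniform hypergraph on $[n]$ is a set of $q$-element subsets of $[n]$, called edges; $e(\mathcal{H})$ is the number of edges. A hypergraph is linear if any two distinct edges $A,B$ satisfy $|A\cap B|\le 1$. A $q$-uniform linear hypergraph $\mathcal{H}$ on $[n]$ is maximal if there is no $q$-subset $e\notin\mathcal{H}$ of $[n]$ such that $\mathcal{H}\cup\{e\}$ is linear. *)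

(* Defs.v *)
From HB Require Import structures.
From mathcomp Require Import all_boot all_order all_algebra.
From mathcomp Require Import reals.
Set Implicit Arguments.
Unset Strict Implicit.
Unset Printing Implicit Defensive.

(* A hypergraph on [n] is its edge set, a {set {set 'I_n}}:
   the vertex set {1, ..., n} is represented by 'I_n = {0, ..., n - 1}, and
   the number of edges is the cardinal #|H|. *)

Definition uniform (n q : nat) (H : {set {set 'I_n}}) : Prop :=
  forall e : {set 'I_n}, e \in H -> #|e| = q.

Definition linear_hypergraph (n : nat) (H : {set {set 'I_n}}) : Prop :=
  forall A B : {set 'I_n}, A \in H -> B \in H -> A <> B -> #|A :&: B| <= 1.

Definition maximal_linear (n q : nat) (H : {set {set 'I_n}}) : Prop :=
  [/\ uniform q H, linear_hypergraph H &
      ~ exists e : {set 'I_n},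
          [/\ #|e| = q, e \notin H & linear_hypergraph (e |: H)]].

(* Main.v *)
Require Import Defs.
From HB Require Import structures.
From mathcomp Require Import all_boot all_order all_algebra.
From mathcomp Require Import reals zify.
Import Order.TTheory GRing.Theory Num.Theory.
Local Open Scope ring_scope.

(* Adding the edges one at a time, the i-th edge meets the union of the
   previous i - 1 in at most i - 1 vertices, so m edges cover at least
   m q - m (m - 1) / 2 vertices.  For m = q this exceeds q ^ 2 / 2 >= n, hence
   m < q, and then the same inequality gives m q <= 2 n.  Conversely, if H is
   maximal, fewer than q vertices are uncovered (q of them would form a new
   edge), so n < (m + 1) q, and m + 1 <= 2 m because q <= n forces m >= 1. *)

Lemma exists_subset_card (T : finType) (A : {set T}) (k : nat) :
  (k <= #|A|)%N -> exists2 B : {set T}, B \subset A & #|B| = k.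
Proof.
move=> lekA; have: (0 < #|[set B : {set T} | B \subset A & #|B| == k]|)%N.
  by rewrite cards_draws bin_gt0.
by case/card_gt0P => B; rewrite inE => /andP[sBA /eqP cB]; exists B.
Qed.

Lemma card_setI_cover_le (T : finType) (A : {set T}) (K : {set {set T}}) :
  (forall B, B \in K -> #|A :&: B| <= 1)%N -> (#|A :&: cover K| <= #|K|)%N.
Proof.
move=> leAK; rewrite /cover big_distrr /= -[leqRHS]sum1_card.
elim/big_ind2: _ => [|m X k Y leX leY|B BK]; first by rewrite cards0.
  by rewrite (leq_trans (leq_card_setU _ _)) // leq_add.
exact: leAK.
Qed.

Lemma linear_cover_lower_bound (n q : nat) (H : {set {set 'I_n}}) :
  uniform q H -> linear_hypergraph H ->
  (2 * #|H| * q <= 2 * #|cover H| + #|H| * #|H|.-1)%N.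
Proof.
move=> uH lH; have [m] := ubnP #|H|.
elim: m => // m IHm in H uH lH *; rewrite ltnS => leHm.
have [->|[A AH]] := set_0Vmem H; first by rewrite cards0.
pose K := H :\ A.
have cH : #|H| = #|K|.+1 by rewrite (cardsD1 A) AH.
have KH B : B \in K -> B != A /\ B \in H by case/setD1P.
have IH : (2 * #|K| * q <= 2 * #|cover K| + #|K| * #|K|.-1)%N.
  apply: IHm; [by move=> B /KH[_ /uH] | | by rewrite -cH].
  by move=> B C /KH[_ BH] /KH[_ CH]; apply: lH.
have leI : (#|A :&: cover K| <= #|K|)%N.
  apply: card_setI_cover_le => B /KH[/eqP nBA BH].
  by apply: lH => // eAB; apply: nBA.
have cvH : cover H = A :|: cover K by rewrite /cover (big_setD1 A).
have sqK : (#|K| * #|K|.-1 + #|K| = #|K| * #|K|)%N by case: #|K| => // k; lia.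
have := cardsUI A (cover K); rewrite -cvH (uH _ AH) cH /=.
move: sqK leI IH => {cH}.
move: #|K| #|cover K| #|cover H| #|A :&: cover K| => k c c' i; nia.
Qed.

Lemma linear_card_lt (n q : nat) (H : {set {set 'I_n}}) :
  (1 <= n)%N -> (2 * n <= q * q)%N -> uniform q H -> linear_hypergraph H ->
  (#|H| < q)%N.
Proof.
move=> n1 nq uH lH; rewrite ltnNge; apply/negP => /exists_subset_card[K sKH cK].
have uK : uniform q K by move=> B /(subsetP sKH) /uH.
have lK : linear_hypergraph K.
  by move=> A B /(subsetP sKH) AH /(subsetP sKH) BH; apply: lH.
have := linear_cover_lower_bound _ _ _ uK lK; rewrite cK.
have : (#|cover K| <= n)%N by rewrite -[leqRHS]card_ord max_card.
by move: #|cover K| => c; case: q nq {uH uK cK} => [|k] /=; nia.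
Qed.

Lemma linear_card_mul_le (n q : nat) (H : {set {set 'I_n}}) :
  (1 <= n)%N -> (2 * n <= q * q)%N -> uniform q H -> linear_hypergraph H ->
  (#|H| * q <= 2 * n)%N.
Proof.
move=> n1 nq uH lH; have := linear_card_lt _ _ _ n1 nq uH lH.
have := linear_cover_lower_bound _ _ _ uH lH.
have : (#|cover H| <= n)%N by rewrite -[leqRHS]card_ord max_card.
by move: #|cover H| #|H| => c [|k] /=; nia.
Qed.

Lemma maximal_linear_uncovered (n q : nat) (H : {set {set 'I_n}}) :
  (0 < q)%N -> maximal_linear q H -> (#|~: cover H| < q)%N.
Proof.
move=> q0 [uH lH maxH]; rewrite ltnNge; apply/negP.
case/exists_subset_card => e eC ce; apply: maxH; exists e.
have disj B : B \in H -> e :&: B = set0.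
  move=> BH; apply/eqP; rewrite setI_eq0 disjoints_subset (subset_trans eC) //.
  by rewrite setCS bigcup_sup.
split=> // [|A B].
  apply/negP => /disj; rewrite setIid => e0.
  by rewrite -ce e0 cards0 in q0.
case/setU1P => [->|AH] /setU1P[->|BH] nAB //.
- by rewrite disj // cards0.
- by rewrite setIC disj // cards0.
- exact: lH.
Qed.

Lemma maximal_linear_card_mul_ge (n q : nat) (H : {set {set 'I_n}}) :
  (0 < q)%N -> (q <= n)%N -> maximal_linear q H -> (n <= 2 * (#|H| * q))%N.
Proof.
move=> q0 qn mH; have := maximal_linear_uncovered _ _ _ q0 mH.
have [uH _ _] := mH.
have : (#|cover H| <= #|H| * q)%N.
  rewrite (leq_trans (leq_card_cover H)) // -sum_nat_const.
  by apply: leq_sum => B /uH ->.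
have := cardsC (cover H); rewrite card_ord.
by move: #|cover H| #|~: cover H| #|H| => c u [|m]; nia.
Qed.

Lemma sqrt_double_le_nat (R : realType) (n q : nat) :
  Num.sqrt (2 * n%:R : R) <= q%:R -> (2 * n <= q * q)%N.
Proof.
move=> le_sq; rewrite -(ler_nat R) !natrM -expr2.
by rewrite -(@sqr_sqrtr R (2 * n%:R)) ?mulr_ge0 // lerXn2r ?nnegrE ?sqrtr_ge0.
Qed.

Theorem proposition2 (R : realType) :
  (forall (n q : nat) (H : {set {set 'I_n}}),
     (1 <= n)%N -> Num.sqrt (2 * n%:R : R) <= q%:R ->
     uniform q H -> linear_hypergraph H ->
     (#|H| < q)%N)
  /\
  (exists c C : R,
     [/\ 0 < c, 0 < C &
       forall (n q : nat) (H : {set {set 'I_n}}),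
         (1 <= n)%N -> Num.sqrt (2 * n%:R : R) <= q%:R ->
         (q <= n)%N -> maximal_linear q H ->
         c * (n%:R / q%:R) <= #|H|%:R <= C * (n%:R / q%:R)]).
Proof.
split=> [n q H n1 /sqrt_double_le_nat nq|]; first exact: linear_card_lt.
exists 2^-1, 2; split=> [||n q H n1 /sqrt_double_le_nat nq qn mH].
- by rewrite invr_gt0.
- by [].
have q0 : (0 < q)%N by nia.
have [uH lH _] := mH.
rewrite mulrA ler_pdivrMr ?ltr0n // mulrA ler_pdivlMr ?ltr0n //.
rewrite ler_pdivrMl // -!natrM !ler_nat.
by rewrite maximal_linear_card_mul_ge // linear_card_mul_le.
Qed.
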